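(* Let $B,\bar B$ be real or complex vector spaces and $L(\varepsilon)=\sum_{i=0}^\infty\varepsilon^iL_i$ a formal power series with $L_i\in L(B,\bar B)$, $L(\varepsilon)\not\equiv0$. Let $k\ge0$, assume that $L(\varepsilon)$ stabilizes at $k$, and run the recursion of the context with some choice of complements. Let $H_1,\dots,H_{k+1}\in L(\bar B,B)$ be the operators defined in the context. Then for every $l\ge k+1$ $$\begin{pmatrix} M_{1,k+1+l} \\ \vdots \\ M_{k+1,k+1+l} \end{pmatrix}=\begin{pmatrix} H_1 & & \\ \vdots & \ddots & \\ H_{k+1} & \cdots & H_1 \end{pmatrix}\cdot\begin{pmatrix} \bar S_{k+1+l} \\ \vdots \\ \bar S_{1+l} \end{pmatrix},$$ where the matrix on the right is the lower triangular $(k+1)\times(k+1)$ block Toeplitz matrix with $(i,j)$ entry $H_{i-j+1}$ for $i\ge j$; that is, $M_{i,k+1+l}=\sum_{j=1}^{i}H_{i-j+1}\bar S_{k+2+l-j}$ for $i=1,\dots,k+1$.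
   Context: $L(X,Y)$ denotes the linear maps from $X$ to $Y$; $N[T]$ is the kernel of $T$; $I_X$ is the identity. Stabilization. For $k\ge1$ let $\Delta^k:B^k\to\bar B^k$ be the upper triangular block Toeplitz operator with $(i,j)$ entry $L_{j-i}$ for $j\ge i$ and $0$ otherwise, so that $\Delta^k(b_{k-1},\dots,b_0)^T=0$ iff $\sum_{i+j=m}L_ib_j=0$ for $m=0,\dots,k-1$. For $b_0\in B$ put $\mathrm{rank}(b_0)=0$ if $b_0\notin N[L_0]$, and otherwise $\mathrm{rank}(b_0)=\sup\{k\ge1\mid\exists (b_{k-1},\dots,b_0)\in B^k:\ \Delta^k(b_{k-1},\dots,b_0)^T=0\}\in\mathbb{N}\cup\{\infty\}$. $L(\varepsilon)$ stabilizes at $k\ge0$ if $\mathrm{rank}(b_0)\in\{0,\dots,k\}\cup\{\infty\}$ for all $b_0\in B$ and there exists $b_0$ with $\mathrm{rank}(b_0)=k$. Recursion. Put $N_0:=B$, $N_0^c:=\{0\}$, $R_0:=\{0\}$, $R_0^c:=\bar B$, $\bar S_1:=S_1:=L_0$, $E_{1,1}:=M_{1,1}:=I_B$. At each stage $j\ge1$, given $S_j\in L(B,R_{j-1}^c)$, set $N_j:=\{n\in N_{j-1}\mid S_jn=0\}$, $R_j:=S_j(N_{j-1})$ and choose algebraic direct complements $N_{j-1}=N_j^c\oplus N_j$, $R_{j-1}^c=R_j\oplus R_j^c$. Then $B=N_1^c\oplus\cdots\oplus N_j^c\oplus N_j$ and $\bar B=R_1\oplus\cdots\oplus R_j\oplus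 R_j^c$; $\mathcal P_j$ denotes the projection of $\bar B$ onto $R_j$ defined by the latter decomposition, and $S_j^{-1}:R_j\to N_j^c$ denotes the inverse of the bijection $S_j|_{N_j^c}:N_j^c\to R_j$. At stage $j\ge2$, the operators are defined by $$\bar S_j:=\sum_{i=1}^{j-1}L_iM_{i,j-1},\qquad S_j:=(I_{\bar B}-\mathcal P_1-\cdots-\mathcal P_{j-1})\bar S_j,$$ $$E_{j,j}:=I_B,\qquad E_{i,j}:=-S_i^{-1}\mathcal P_i\sum_{\nu=i+1}^{j}\bar S_\nu E_{\nu,j}\quad (i=j-1,\dots,1),$$ $$M_{1,j}:=E_{1,j},\qquad M_{i,j}:=\sum_{\nu=i}^{j}M_{i-1,\nu-1}E_{\nu,j}\quad(i=2,\dots,j).$$ The recursion is continued for all $j$. $M^{(k)}$ is the upper triangular $k\times k$ operator matrix with entries $M_{i,j}$ for $i\le j$ and $0$ for $i>j$. Operators $H_i$. Put $B_i:=\bar S_iS_i^{-1}\mathcal P_i\in L(\bar B,\bar B)$, and $$e_{k+1,k+2}:=-S_{k+1}^{-1}\mathcal P_{k+1},\qquad e_{i,k+2}:=-S_i^{-1}\mathcal P_i(I_{\bar B}-B_{i+1})\cdots(I_{\bar B}-B_{k+1})\quad(1\le i\le k).$$ Then $$\begin{pmatrix} H_1 \\ \vdots \\ H_{k+1} \end{pmatrix}:=\begin{pmatrix} I_B & 0 \\ 0 & M^{(k)} \end{pmatrix}\cdot\begin{pmatrix} e_{1,k+2} \\ \vdots \\ e_{k+1,k+2} \end{pmatrix}$$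 (for $k=0$ this reads $H_1=e_{1,2}=-S_1^{-1}\mathcal P_1$). *)

(* Defs.v *)
From HB Require Import structures.
From mathcomp Require Import all_boot all_order all_algebra.
From mathcomp Require Import boolp classical_sets reals constructive_ereal ereal.
From mathcomp Require Import complex.

Set Implicit Arguments.
Unset Strict Implicit.
Unset Printing Implicit Defensive.

Import Order.TTheory GRing.Theory Num.Theory.

Local Open Scope classical_set_scope.
Local Open Scope ring_scope.

Inductive scalar_kind : Type := RealScalars | ComplexScalars.

Definition scalars (R : realType) (c : scalar_kind) : fieldType :=
  match c with
  | RealScalars => R
  | ComplexScalars => R[i]
  end.

(* [W] is the internal direct sum of its linear subspaces [U1] and [U2];
   [W] may be an infinite-dimensional subspace of [V]. *)
Definition direct_sum (K : fieldType) (V : lmodType K) (W U1 U2 : set V) : Prop :=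
  [/\ submod_closed [in U1], submod_closed [in U2],
      U1 `&` U2 = [set 0]
    & W = [set u1 + u2 | u1 in U1 & u2 in U2]].

Section Stabilization.
Variables (R : realType) (K : fieldType) (B Bbar : lmodType K).

(* A formal power series is the sequence [L] of its coefficients. *)
Implicit Type L : nat -> {linear B -> Bbar}.

(* Indices run over [0, k-1] instead of [1, k]; only [j - i] matters. *)
Definition Delta L (k : nat) (x : {ffun 'I_k -> B}) : {ffun 'I_k -> Bbar} :=
  [ffun i : 'I_k => \sum_(j < k | (i <= j)%N) L (j - i)%N (x j)].

(* There are b_1, ..., b_{k-1} with Delta^k (b_{k-1}, ..., b_0)^T = 0: only the
   first [k] values of [b] matter, and [rev_ord] puts them in reverse order. *)
Definition in_kernel_chain L (k : nat) (b0 : B) : Prop :=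
  exists b : nat -> B,
    b 0%N = b0 /\ Delta L [ffun j : 'I_k => b (rev_ord j)] = 0.

Definition rank L (b0 : B) : \bar R :=
  if L 0%N b0 == 0 then
    ereal_sup [set (k%:R)%:E |
                k in [set k : nat | (1 <= k)%N /\ in_kernel_chain L k b0]]
  else 0%:E.

Definition stabilizes_at L (k : nat) : Prop :=
  (forall b0, (exists2 m : nat, (m <= k)%N & rank L b0 = (m%:R)%:E)
              \/ rank L b0 = +oo%E)
  /\ exists b0, rank L b0 = (k%:R)%:E.

End Stabilization.

Section Recursion.
Variables (K : fieldType) (B Bbar : lmodType K).
Variable L : nat -> {linear B -> Bbar}.

(* A run of the recursion.  The only free data are the complements [Ncompl j]
   and [Rcompl j], j >= 1; the axioms determine the other components at the
   indices that are used (1 <= i <= j for [Eop i j] and [Mop i j]), the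
   remaining values being arbitrary.  [Sinv j] stands for the
   inverse R_j -> N_j^c of the restriction of S_j to N_j^c; it is constrained on
   R_j only. *)
Record recursion_run := RecursionRun {
  Nspace : nat -> set B;
  Ncompl : nat -> set B;
  Rspace : nat -> set Bbar;
  Rcompl : nat -> set Bbar;
  Sbar : nat -> {linear B -> Bbar};
  Sop : nat -> {linear B -> Bbar};
  Pproj : nat -> {linear Bbar -> Bbar};
  Sinv : nat -> Bbar -> B;
  Eop : nat -> nat -> {linear B -> B};
  Mop : nat -> nat -> {linear B -> B};

  run_N0E : Nspace 0%N = setT;
  run_Nc0E : Ncompl 0%N = [set 0];
  run_R0E : Rspace 0%N = [set 0];
  run_Rc0E : Rcompl 0%N = setT;
  run_Sbar1E : forall b, Sbar 1%N b = L 0%N b;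
  run_S1E : forall b, Sop 1%N b = L 0%N b;
  run_E11 : forall b, Eop 1%N 1%N b = b;
  run_M11 : forall b, Mop 1%N 1%N b = b;

  run_NE : forall j, (1 <= j)%N ->
    Nspace j = [set n | Nspace j.-1 n /\ Sop j n = 0];
  run_RE : forall j, (1 <= j)%N -> Rspace j = Sop j @` Nspace j.-1;
  run_N_split : forall j, (1 <= j)%N ->
    direct_sum (Nspace j.-1) (Ncompl j) (Nspace j);
  run_Rc_split : forall j, (1 <= j)%N ->
    direct_sum (Rcompl j.-1) (Rspace j) (Rcompl j);

  (* P_j is the projection onto R_j along the decomposition
     Bbar = R_1 (+) ... (+) R_j (+) R_j^c. *)
  run_PE : forall j (r : nat -> Bbar) (rc : Bbar), (1 <= j)%N ->
    (forall i, (1 <= i <= j)%N -> Rspace i (r i)) -> Rcompl j rc ->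
    Pproj j (\sum_(1 <= i < j.+1) r i + rc) = r j;
  run_SinvE : forall j y, (1 <= j)%N -> Rspace j y ->
    Ncompl j (Sinv j y) /\ Sop j (Sinv j y) = y;

  run_SbarE : forall j b, (2 <= j)%N ->
    Sbar j b = \sum_(1 <= i < j) L i (Mop i j.-1 b);
  run_SE : forall j b, (2 <= j)%N ->
    Sop j b = Sbar j b - \sum_(1 <= i < j) Pproj i (Sbar j b);
  run_EjjE : forall j b, (2 <= j)%N -> Eop j j b = b;
  run_EijE : forall i j b, (2 <= j)%N -> (1 <= i < j)%N ->
    Eop i j b =
      - Sinv i (Pproj i (\sum_(i.+1 <= nu < j.+1) Sbar nu (Eop nu j b)));
  run_M1jE : forall j b, (2 <= j)%N -> Mop 1%N j b = Eop 1%N j b;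
  run_MijE : forall i j b, (2 <= j)%N -> (2 <= i <= j)%N ->
    Mop i j b = \sum_(i <= nu < j.+1) Mop i.-1 nu.-1 (Eop nu j b)
}.

Variables (r : recursion_run) (k : nat).

(* The operator written B_i in the mathematics. *)
Definition Bop (i : nat) (y : Bbar) : Bbar := Sbar r i (Sinv r i (Pproj r i y)).

(* The operator e_{i,k+2} for 1 <= i <= k+1; the product of the factors
   I - B_{i+1}, ..., I - B_{k+1}, in this order, is empty for i = k+1. *)
Definition e_op (i : nat) (y : Bbar) : B :=
  - Sinv r i (Pproj r i
      ((\big[comp/idfun]_(i.+1 <= j < k.+2) (fun z : Bbar => z - Bop j z)) y)).

(* The (i, j) entry of M^(k), 1 <= i, j <= k. *)
Definition Mk (i j : nat) (b : B) : B := if (i <= j)%N then Mop r i j b else 0.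

(* The (i, j) entry of diag(I_B, M^(k)), 1 <= i, j <= k+1. *)
Definition diagMk (i j : nat) (b : B) : B :=
  if (i == 1%N) && (j == 1%N) then b
  else if (i == 1%N) || (j == 1%N) then 0
  else Mk i.-1 j.-1 b.

Definition H_op (i : nat) (y : Bbar) : B :=
  \sum_(1 <= j < k.+2) diagMk i j (e_op j y).

End Recursion.

(* Main.v *)
Require Import Defs.
From HB Require Import structures.
From mathcomp Require Import all_boot all_order all_algebra.
From mathcomp Require Import boolp classical_sets reals constructive_ereal ereal.
From mathcomp Require Import complex zify.

Import Order.TTheory GRing.Theory Num.Theory.

Local Open Scope ring_scope.

(* The recursion is arranged so that the nu-sum of Sbar_nu E_(nu,j) equals S_j,
   whence Delta^k M^(k) is the block Toeplitz matrix of S_1, ..., S_k.  As M^(k)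
   is unipotent triangular and the R_i are independent, a kernel chain of length
   k starts at b exactly when b lies in N_k.  Stabilization at k therefore means
   N_j = N_(k+1), hence P_j = 0, for all j > k + 1.  For J > k + 1 this leaves
   E_(i,J) = e_(i,k+2) Sbar_J if i <= k + 1, and E_(i,J) = 0 if k + 1 < i < J,
   so the recursion for M becomes M_(i,J) = H_i Sbar_J + M_(i-1,J-1), which
   unrolls to the Toeplitz formula. *)

Lemma big_nat_eq0 (V : nmodType) (m n : nat) (F : nat -> V) :
  (forall i, (m <= i < n)%N -> F i = 0) -> \sum_(m <= i < n) F i = 0.
Proof. by move=> F0; rewrite big_nat big1. Qed.

Lemma big_triangle (V : nmodType) (a n : nat) (F : nat -> nat -> V) :
  \sum_(a <= i < n) \sum_(i <= j < n) F i j =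
  \sum_(a <= j < n) \sum_(a <= i < j.+1) F i j.
Proof.
transitivity (\sum_(a <= i < n) \sum_(a <= j < n | (i <= j)%N) F i j).
  apply: eq_big_nat => i /andP[ai _].
  by rewrite (big_nat_widenl i a n) //; apply: eq_bigl.
rewrite (exchange_big_dep_nat xpredT) //; apply: eq_big_nat => j /andP[_ jn].
by rewrite (big_nat_widen a j.+1 n) //; apply: eq_bigl => i; rewrite ltnS.
Qed.

Lemma direct_sum_elim {K : fieldType} {V : lmodType K} {W U1 U2 : set V} :
  direct_sum W U1 U2 ->
  [/\ U1 0, U2 0, (forall x, W x -> exists u v, [/\ U1 u, U2 v & x = u + v]),
      (forall u v, U1 u -> U2 v -> W (u + v)) &
      forall x, U1 x -> U2 x -> x = 0].
Proof.
case=> -[U10 _] [U20 _] UI ->; split.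
- by move: U10; rewrite unfold_in /= inE.
- by move: U20; rewrite unfold_in /= inE.
- by move=> x [u Uu [v Uv <-]]; exists u, v.
- by move=> u v Uu Uv; exists u => //; exists v.
- by move=> x x1 x2; have : [set 0]%classic x by rewrite -UI.
Qed.

Section Recursion.
Set Implicit Arguments.
Unset Strict Implicit.

Variables (K : fieldType) (B Bbar : lmodType K) (L : nat -> {linear B -> Bbar}).
Variable r : recursion_run L.

Local Notation N := (Nspace r).
Local Notation Nc := (Ncompl r).
Local Notation Rs := (Rspace r).
Local Notation Rc := (Rcompl r).
Local Notation Sb := (Sbar r).
Local Notation S := (Sop r).
Local Notation P := (Pproj r).
Local Notation E := (Eop r).
Local Notation M := (Mop r).

Lemma Nspace_subset i j : (i <= j)%N -> forall x, N j x -> N i x.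
Proof.
move=> /subnK <- x; elim: (j - i)%N => // d IHd.
by rewrite addSn run_NE // => -[/IHd].
Qed.

Lemma Sop_Nspace j x : (0 < j)%N -> N j x -> S j x = 0.
Proof. by move=> j0; rewrite run_NE // => -[]. Qed.

Lemma Ncompl_Nspace j x : (0 < j)%N -> Nc j x -> N j.-1 x.
Proof.
move=> j0 Ncx; have [_ N0 _ cl _] := direct_sum_elim (run_N_split r j0).
by rewrite -[x]addr0; apply: cl.
Qed.

Lemma Rspace0 j : Rs j 0.
Proof.
case: j => [|j]; first by rewrite run_R0E.
by have [] := direct_sum_elim (run_Rc_split r (ltn0Sn j)).
Qed.

Lemma Rcompl0 j : Rc j 0.
Proof.
case: j => [|j]; first by rewrite run_Rc0E.
by have [] := direct_sum_elim (run_Rc_split r (ltn0Sn j)).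
Qed.

Lemma Rcompl_subset i j : (i <= j)%N -> forall x, Rc j x -> Rc i x.
Proof.
move=> /subnK <- x; elim: (j - i)%N => // d IHd.
rewrite addSn => Rx; apply: IHd.
have [_ _ _ cl _] := direct_sum_elim (run_Rc_split r (ltn0Sn (d + i))).
by rewrite -[x]add0r; apply: cl => //; apply: Rspace0.
Qed.

Lemma Rspace_Rcompl j x : (0 < j)%N -> Rs j x -> Rc j.-1 x.
Proof.
move=> j0 Rx; have [_ _ _ cl _] := direct_sum_elim (run_Rc_split r j0).
by rewrite -[x]addr0; apply: cl => //; apply: Rcompl0.
Qed.

Lemma Pproj_single i j u v : (0 < i <= j)%N -> Rs i u -> Rc j v ->
  P j (u + v) = if i == j then u else 0.
Proof.
move=> /andP[i0 ij] Ru Rv.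
rewrite -(run_PE (j := j) (r := fun m => if i == m then u else 0) _ _ Rv).
- congr (P j (_ + v)); rewrite (big_cat_nat (n := i)) //=; last lia.
  rewrite (@big_ltn _ _ _ i) ?ltnS // eqxx !big_nat_eq0 ?add0r ?addr0 //.
  - by move=> m; case: eqP => //; lia.
  - by move=> m; case: eqP => //; lia.
- lia.
- by move=> m _; case: eqP => [<- //|_]; apply: Rspace0.
Qed.

Lemma Pproj_compl i j y : (0 < i <= j)%N -> Rc j y -> P i y = 0.
Proof.
move=> /andP[i0 ij] Ry; rewrite -[y]add0r (Pproj_single (i := i)) ?eqxx ?i0 ?leqnn //.
- exact: Rspace0.
- exact: Rcompl_subset Ry.
Qed.

Lemma Pproj_Rspace i j y : (0 < i)%N -> (0 < j)%N -> Rs i y ->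
  P j y = if i == j then y else 0.
Proof.
move=> i0 j0 Ry; have [ij|ji] := leqP i j.
  by rewrite -[in LHS](addr0 y) (Pproj_single (i := i)) ?i0 //; apply: Rcompl0.
rewrite gtn_eqF //; apply: (@Pproj_compl _ i.-1); first lia.
exact: Rspace_Rcompl.
Qed.

Definition residue j (y : Bbar) := y - \sum_(1 <= i < j) P i y.

Lemma residue_sum j (I : Type) (s : seq I) (F : I -> Bbar) :
  residue j (\sum_(x <- s) F x) = \sum_(x <- s) residue j (F x).
Proof.
rewrite sumrB exchange_big /=; congr (_ - _).
by apply: eq_bigr => i _; rewrite linear_sum.
Qed.

Lemma residueD j x y : residue j (x + y) = residue j x + residue j y.
Proof.
rewrite /residue addrACA -opprD -big_split /=; congr (_ - _).
by apply: eq_bigr => i _; rewrite linearD.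
Qed.

Lemma residue_spec j y : (0 < j)%N ->
  Rc j.-1 (residue j y) /\ forall i, (0 < i < j)%N -> Rs i (P i y).
Proof.
case: j => // j _; elim: j => [|j [IHc IHr]] /=.
  by rewrite run_Rc0E; split => // i; lia.
have [_ _ dec _ _] := direct_sum_elim (run_Rc_split r (ltn0Sn j)).
have [u [v [Ru Rv Euv]]] := dec _ IHc.
have Py : P j.+1 y = u.
  have Ey : y = u + v + \sum_(1 <= i < j.+1) P i y by rewrite -Euv subrK.
  rewrite [in LHS]Ey linearD (Pproj_single (i := j.+1)) // ?eqxx ?leqnn //.
  rewrite linear_sum big_nat_eq0 ?addr0 // => i lti.
  rewrite (Pproj_Rspace (i := i)) //; [by rewrite ltn_eqF //; lia | lia |].
  by apply: IHr; lia.
split.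
  rewrite /residue big_nat_recr //= opprD addrA -/(residue _ _) Euv Py.
  by rewrite addrAC subrr add0r.
move=> i lti; have [->|nij] := eqVneq i j.+1; first by rewrite Py.
by apply: IHr; lia.
Qed.

Lemma Pproj_in j y : (0 < j)%N -> Rs j (P j y).
Proof.
move=> j0; have [_ H] := residue_spec y (ltn0Sn j).
by apply: H; rewrite j0 ltnS leqnn.
Qed.

Lemma residue_Rspace i j y : (0 < i < j)%N -> Rs i y -> residue j y = 0.
Proof.
move=> lij Ry; rewrite /residue (bigD1_seq i) ?mem_index_iota ?iota_uniq //=.
rewrite (Pproj_Rspace (i := i)) //; try lia.
rewrite eqxx big_nat_cond big1 ?addr0 ?subrr // => m mj.
by rewrite (Pproj_Rspace (i := i)) //; try lia; rewrite ifF //; lia.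
Qed.

Lemma Sop_residue j b : (0 < j)%N -> S j b = residue j (Sb j b).
Proof.
case: j => [//|[|j]] _; last by rewrite run_SE.
by rewrite /residue big_geq // subr0 run_S1E run_Sbar1E.
Qed.

Lemma Sbar_split j b : (0 < j)%N ->
  Sb j b = S j b + \sum_(1 <= i < j) P i (Sb j b).
Proof. by move=> j0; rewrite Sop_residue // subrK. Qed.

Lemma Sop_Rspace j b : (0 < j)%N -> N j.-1 b -> Rs j (S j b).
Proof. by move=> j0 Nb; rewrite run_RE //; exists b. Qed.

Lemma Pproj_Sbar i j b : (0 < i)%N -> (0 < j <= i)%N -> N j.-1 b ->
  P i (Sb j b) = if j == i then S j b else 0.
Proof.
move=> i0 /andP[j0 ji] Nb.
rewrite Sbar_split // linearD (Pproj_Rspace (i := j)) //; last exact: Sop_Rspace.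
rewrite linear_sum big_nat_eq0 ?addr0 // => m lm.
by rewrite (Pproj_Rspace (i := m)) ?ltn_eqF //; try lia; apply: Pproj_in; lia.
Qed.

Lemma residue_Sbar i j b : (0 < j < i)%N -> N j.-1 b -> residue i (Sb j b) = 0.
Proof.
move=> /andP[j0 ji] Nb; rewrite Sbar_split // residueD.
rewrite (residue_Rspace (i := j)) ?add0r; try lia; last exact: Sop_Rspace.
rewrite residue_sum big_nat_eq0 // => m lm.
by rewrite (residue_Rspace (i := m)) //; first lia; apply: Pproj_in; lia.
Qed.

Lemma Sinv_in j y : (0 < j)%N -> Rs j y -> Nc j (Sinv r j y).
Proof. by move=> j0 /(run_SinvE j0)[]. Qed.

Lemma SinvK j y : (0 < j)%N -> Rs j y -> S j (Sinv r j y) = y.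
Proof. by move=> j0 /(run_SinvE j0)[]. Qed.

Lemma Ncompl_Sop0 j x : (0 < j)%N -> Nc j x -> S j x = 0 -> x = 0.
Proof.
move=> j0 Nx Sx; have [_ _ _ _ I0] := direct_sum_elim (run_N_split r j0).
apply: I0 => //; rewrite run_NE //; split => //; exact: Ncompl_Nspace.
Qed.

Lemma Sinv0 j : (0 < j)%N -> Sinv r j 0 = 0.
Proof.
move=> j0; apply: (@Ncompl_Sop0 j) => //; last by rewrite SinvK //; apply: Rspace0.
by apply: Sinv_in => //; apply: Rspace0.
Qed.

Lemma Ncompl_opp j x : (0 < j)%N -> Nc j x -> Nc j (- x).
Proof.
move=> /(run_N_split r)[[U0 cl] _ _ _] Nx.
have: -1 *: x + 0 \in [in Nc j] by apply: cl => //; rewrite unfold_in /= inE.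
by rewrite addr0 scaleN1r unfold_in /= inE.
Qed.

Lemma Eop_Ncompl i j b : (0 < i < j)%N -> Nc i (E i j b).
Proof.
move=> /andP[i0 ij]; rewrite run_EijE ?i0 //; last lia.
by apply: Ncompl_opp => //; apply: Sinv_in => //; apply: Pproj_in.
Qed.

Lemma Eop_Nspace i j m b : (0 < i < j)%N -> (m < i)%N -> N m (E i j b).
Proof.
move=> lij mi; apply: (@Nspace_subset m i.-1); first lia.
by apply: Ncompl_Nspace; [lia | exact: Eop_Ncompl].
Qed.

Lemma EopE j b : (0 < j)%N -> E j j b = b.
Proof. by case: j => [|[|j]] // _; [exact: run_E11 | exact: run_EjjE]. Qed.

Lemma MopE j b : (0 < j)%N -> M j j b = b.
Proof.
elim: j b => // -[|j] IHj b _; first exact: run_M11.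
by rewrite run_MijE ?leqnn // big_nat1 IHj // run_EjjE.
Qed.

Lemma sum_Sbar_Eop j b : (0 < j)%N ->
  \sum_(1 <= nu < j.+1) Sb nu (E nu j b) = S j b.
Proof.
move=> j0; set X := LHS.
have PX i : (0 < i < j)%N -> P i X = 0.
  move=> /andP[i0 ij]; rewrite linear_sum /=.
  rewrite (big_cat_nat (n := i)) //=; try lia.
  rewrite big_nat_eq0 ?add0r; last first.
    move=> m lm; rewrite Pproj_Sbar //; first by rewrite ltn_eqF //; lia.
      lia.
    by apply: Eop_Nspace; lia.
  rewrite big_ltn; last lia.
  rewrite Pproj_Sbar ?leqnn ?eqxx ?i0 //; last by apply: Eop_Nspace; lia.
  rewrite run_EijE ?i0 //; last lia.
  rewrite linearN SinvK //; last exact: Pproj_in.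
  by rewrite linear_sum addNr.
have -> : X = residue j X.
  by rewrite /residue big_nat_eq0 ?subr0 // => m lm; apply: PX; lia.
rewrite residue_sum big_nat_recr //= big_nat_eq0 ?add0r.
  by rewrite -Sop_residue // EopE.
move=> m lm; apply: residue_Sbar; first lia.
by apply: Eop_Nspace; lia.
Qed.

Lemma sum_shift_Mop (F : nat -> {linear B -> Bbar}) i j b : (0 < i < j)%N ->
  \sum_(i.+1 <= nu < j.+1) F nu (M nu j b) =
  \sum_(i.+1 <= m < j.+1) \sum_(i <= nu < m) F nu.+1 (M nu m.-1 (E m j b)).
Proof.
move=> lij.
transitivity (\sum_(i.+1 <= nu < j.+1) \sum_(nu <= m < j.+1)
    F nu (M nu.-1 m.-1 (E m j b))).
  apply: eq_big_nat => nu lnu; rewrite run_MijE ?linear_sum //; lia.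
rewrite big_triangle; apply: eq_big_nat => m lm.
by rewrite big_add1.
Qed.

Lemma sum_L_Mop i j b : (0 < i <= j)%N ->
  \sum_(i <= nu < j.+1) L (nu - i) (M nu j b) = S (j - i).+1 b.
Proof.
case: i => // i /= ij; elim: i j b ij => [|i IHi] j b ij.
  rewrite subn1 prednK // -sum_Sbar_Eop //.
  rewrite [LHS]big_ltn ?[RHS]big_ltn //= subnn run_Sbar1E.
  move: ij; rewrite leq_eqVlt => /predU1P[<-|j1].
    by rewrite run_M11 run_E11 !big_geq.
  rewrite run_M1jE //; congr (_ + _).
  rewrite (sum_shift_Mop (fun nu => L (nu - 1))) //=.
  apply: eq_big_nat => m lm; rewrite run_SbarE; last lia.
  by apply: eq_big_nat => nu _; rewrite subn1.
rewrite (sum_shift_Mop (fun nu => L (nu - i.+2))) //.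
transitivity (\sum_(i.+2 <= m < j.+1) S (m.-1 - i.+1).+1 (E m j b)).
  apply: eq_big_nat => m lm; rewrite -IHi; last lia.
  by rewrite prednK; last lia.
rewrite big_nat_recr //= big_nat_eq0 ?add0r.
  rewrite EopE; last lia.
  by congr (S _ b); lia.
move=> m lm; apply: Sop_Nspace => //.
by apply: Eop_Nspace; lia.
Qed.

Lemma Delta_rev k (x : nat -> B) (i : 'I_k) :
  Delta L [ffun j : 'I_k => x (rev_ord j)] i =
  \sum_(i.+1 <= nu < k.+1) L (nu - i.+1) (x (k - nu)%N).
Proof.
rewrite ffunE big_add1 /= big_geq_mkord.
by apply: eq_bigr => j _; rewrite ffunE subSS.
Qed.

Lemma Nspace_chain k b : (0 < k)%N -> N k b -> in_kernel_chain L k b.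
Proof.
move=> k0 Nb; exists (fun j => M (k - j)%N k b); split.
  by rewrite subn0 MopE.
apply/ffunP => i; rewrite (Delta_rev (fun j => M (k - j) k b)) [RHS]ffunE.
transitivity (\sum_(i.+1 <= nu < k.+1) L (nu - i.+1) (M nu k b)).
  by apply: eq_big_nat => nu lnu; rewrite subKn //; lia.
rewrite sum_L_Mop ?ltn_ord //; apply: Sop_Nspace => //.
by apply: Nspace_subset Nb; lia.
Qed.

Lemma Mop_onto k (x : nat -> B) :
  exists c, forall i, (0 < i <= k)%N ->
    x i = \sum_(i <= m < k.+1) M i m (c m).
Proof.
suff H d : (d <= k)%N -> exists c, forall i, (0 < i)%N -> (k - d < i <= k)%N ->
    x i = \sum_(i <= m < k.+1) M i m (c m).
  by have [c Hc] := H k (leqnn k); exists c => i li; apply: Hc; lia.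
elim: d => [|d IHd] dk.
  by exists x => i; lia.
have [|c Hc] := IHd _; first exact: ltnW.
set j := (k - d)%N.
pose y := x j - \sum_(j.+1 <= m < k.+1) M j m (c m).
exists (fun m => if m == j then y else c m) => i i0 li.
have [Ei|nij] := eqVneq i j.
  rewrite big_ltn; last lia.
  rewrite Ei eqxx MopE ?subrK; last lia.
  rewrite /y -[LHS](subrK (\sum_(j.+1 <= m < k.+1) M j m (c m))).
  congr (_ + _); apply: eq_big_nat => m lm.
  by rewrite ifF //; lia.
rewrite Hc //; last lia.
by apply: eq_big_nat => m lm; rewrite ifF //; lia.
Qed.

Lemma sum_Sop_eq0 i k (c : nat -> B) : (0 < i)%N ->
  (forall m, (i <= m <= k)%N -> N (m - i) (c m)) ->
  \sum_(i <= m < k.+1) S (m - i).+1 (c m) = 0 ->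
  forall m, (i <= m <= k)%N -> S (m - i).+1 (c m) = 0.
Proof.
move=> i0 Nc S0 m lm.
have /(congr1 (P (m - i).+1)) := S0; rewrite linear0 linear_sum /=.
rewrite (bigD1_seq m) ?mem_index_iota ?iota_uniq //=.
rewrite (Pproj_Rspace (i := (m - i).+1)) ?eqxx //; last first.
  by apply: Sop_Rspace => //=; apply: Nc.
rewrite big_nat_cond big1 ?addr0 // => n ln.
rewrite (Pproj_Rspace (i := (n - i).+1)) //; first by rewrite ifF //; lia.
by apply: Sop_Rspace => //=; apply: Nc; lia.
Qed.

Lemma chain_Nspace k b : (0 < k)%N -> in_kernel_chain L k b -> N k b.
Proof.
move=> k0 [x [x0 Dx]].
have [c Hc] := Mop_onto k (fun nu => x (k - nu)%N).
have S0 i : (0 < i <= k)%N -> \sum_(i <= m < k.+1) S (m - i).+1 (c m) = 0.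
  case: i => // i lik; have /ffunP/(_ (Ordinal lik)) := Dx.
  rewrite Delta_rev [X in _ = X]ffunE /= => D0; rewrite -[RHS]D0.
  transitivity (\sum_(i.+1 <= nu < k.+1) \sum_(nu <= m < k.+1)
      L (nu - i.+1) (M nu m (c m))).
    rewrite big_triangle; apply: eq_big_nat => m lm.
    by rewrite sum_L_Mop //; lia.
  apply: eq_big_nat => nu lnu; rewrite -linear_sum -Hc //; lia.
(* Row i of the Toeplitz system, read from the bottom up: its terms lie in
   R_1, R_2, ... once the rows below have been solved, so each one vanishes. *)
have Nc d i m : (d <= k)%N -> i = (k - d).+1 -> (i <= m <= k)%N ->
    N (m - i).+1 (c m).
  elim: d i m => [|d IHd] i m dk Ei lm; first lia.
  have Nm n : (i <= n <= k)%N -> N (n - i) (c n).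
    move=> ln; have [->|ni] := eqVneq n i; first by rewrite subnn run_N0E.
    have -> : (n - i = (n - i.+1).+1)%N by lia.
    by apply: IHd; lia.
  rewrite run_NE //; split; first exact: Nm.
  by apply: (@sum_Sop_eq0 i k) => //; [lia | apply: S0; lia].
have := Nc k 1%N k (leqnn k); rewrite subnn subn1 prednK // => Nk.
have := Hc k; rewrite subnn big_nat1 MopE // x0 k0 leqnn => -> //.
by apply: Nk; rewrite ?leqnn ?k0.
Qed.

Lemma stabilizes_Nspace (R : realType) k : stabilizes_at R L k ->
  forall j b, N k.+1 b -> N j b.
Proof.
move=> [stab _] j b Nb.
have Lb : L 0%N b = 0.
  by rewrite -(run_S1E r); apply: Sop_Nspace => //; apply: Nspace_subset Nb.
have rankE : rank R L b = ereal_sup [set (m%:R)%:E |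
    m in [set m : nat | (1 <= m)%N /\ in_kernel_chain L m b]]%classic.
  by rewrite /rank Lb eqxx.
have rank_ge : (((k.+1)%:R)%:E <= rank R L b)%E.
  rewrite rankE; apply: ereal_sup_ubound; exists k.+1 => //.
  by split=> //; apply: Nspace_chain.
have rank_oo : rank R L b = +oo%E.
  case: (stab b) => // -[m mk rm]; move: rank_ge.
  by rewrite rm lee_fin ler_nat; lia.
have : ((j%:R)%:E < rank R L b)%E by rewrite rank_oo ltry.
rewrite rankE => /ereal_sup_gt[_ [m [m0 chm] <-]].
rewrite lte_fin ltr_nat => /ltnW jm.
by apply: (Nspace_subset jm); apply: chain_Nspace.
Qed.

Section StableRange.
Variable k : nat.
Hypothesis Nstable : forall j b, N k.+1 b -> N j b.

Lemma Sinv_Pproj0 j y : (k.+2 <= j)%N -> Sinv r j (P j y) = 0.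
Proof.
move=> jk; have j0 : (0 < j)%N by lia.
suff -> : P j y = 0 by rewrite Sinv0.
have := Pproj_in y j0; rewrite run_RE // => -[x Nx <-].
apply: Sop_Nspace => //; apply: Nstable.
by apply: Nspace_subset Nx; lia.
Qed.

Lemma Eop_eq0 i j b : (k.+2 <= i < j)%N -> E i j b = 0.
Proof.
by move=> lij; rewrite run_EijE; try lia; rewrite Sinv_Pproj0 ?oppr0 //; lia.
Qed.

Lemma Sbar_Eop_tail i j b : (i <= k.+1)%N -> (k.+2 <= j)%N ->
  \sum_(i.+1 <= nu < j.+1) Sb nu (E nu j b) =
  (\big[comp/idfun]_(i.+1 <= nu < k.+2) (fun z : Bbar => z - Bop r nu z))
    (Sb j b).
Proof.
move=> ik kj; move: {-2}i ik (erefl (k.+1 - i)%N).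
elim: (k.+1 - i)%N => [|d IHd] {}i ik Ed.
  have -> : i = k.+1 by lia.
  rewrite [in RHS]big_geq //= big_nat_recr //= EopE; last lia.
  rewrite big_nat_eq0 ?add0r // => nu lnu.
  by rewrite Eop_eq0 ?linear0.
have IH := IHd i.+1 _ _.
rewrite [LHS]big_ltn; last lia.
rewrite [X in X (Sb j b)]big_ltn; last lia.
rewrite /= /Bop -IH; try lia.
by rewrite run_EijE; [rewrite linearN addrC | lia | lia].
Qed.

Lemma Eop_e_op i j b : (0 < i <= k.+1)%N -> (k.+2 <= j)%N ->
  E i j b = e_op r k i (Sb j b).
Proof.
by move=> li kj; rewrite run_EijE; try lia; rewrite Sbar_Eop_tail //; lia.
Qed.

Lemma Mop1_H_op j b : (k.+2 <= j)%N -> M 1 j b = H_op r k 1 (Sb j b).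
Proof.
move=> kj; rewrite run_M1jE; last lia.
rewrite Eop_e_op //.
by rewrite /H_op big_ltn //= big_nat_eq0 ?addr0 // => -[|[]].
Qed.

Lemma Mop_H_op i j b : (1 < i <= k.+1)%N -> (k.+2 <= j)%N ->
  M i j b = H_op r k i (Sb j b) + M i.-1 j.-1 b.
Proof.
move=> li kj; rewrite run_MijE; try lia.
rewrite big_nat_recr /=; last lia.
rewrite EopE; last lia.
congr (_ + _).
rewrite (big_cat_nat (n := k.+2)) /=; try lia.
rewrite [X in _ + X]big_nat_eq0 ?addr0; last first.
  by move=> nu lnu; rewrite Eop_eq0 ?linear0 //; lia.
rewrite /H_op [RHS](big_cat_nat (n := i)) /=; try lia.
rewrite [X in _ = X + _]big_nat_eq0 ?add0r; last first.
  move=> nu lnu; rewrite /diagMk /Mk.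
  case: ifP => [|_]; first lia.
  case: ifP => // _; rewrite ifF //; lia.
apply: eq_big_nat => nu lnu; rewrite Eop_e_op //; last lia.
rewrite /diagMk /Mk ifF; last lia.
rewrite ifF; last lia.
by rewrite ifT //; lia.
Qed.

Lemma Mop_Toeplitz i j b : (0 < i <= k.+1)%N -> (k.+1 + i <= j)%N ->
  M i j b = \sum_(1 <= m < i.+1) H_op r k (i - m + 1)%N (Sb (j + 1 - m)%N b).
Proof.
elim: i j => // -[|i] IHi j li ij.
  by rewrite big_nat1 addnK Mop1_H_op //; lia.
rewrite Mop_H_op; try lia.
rewrite big_ltn // IHi; try lia.
congr (_ + _); first by congr (H_op r k _ (Sb _ b)); lia.
rewrite [RHS]big_add1 /=; apply: eq_big_nat => m lm.
by congr (H_op r k _ (Sb _ b)); lia.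
Qed.

End StableRange.

End Recursion.

Theorem lemma4 (R : realType) (c : scalar_kind) (B Bbar : lmodType (scalars R c))
    (L : nat -> {linear B -> Bbar}) (k : nat) (r : recursion_run L)
    (L_neq0 : exists (i : nat) (b : B), L i b != 0)
    (L_stab : stabilizes_at R L k)
    (l : nat) (hl : (k.+1 <= l)%N)
    (i : nat) (hi : (1 <= i <= k.+1)%N) (b : B) :
  Mop r i (k + 1 + l)%N b =
  \sum_(1 <= j < i.+1) H_op r k (i - j + 1)%N (Sbar r (k + 2 + l - j)%N b).
Proof.
rewrite (Mop_Toeplitz (stabilizes_Nspace (r := r) L_stab)) //; last lia.
by apply: eq_big_nat => j lj; congr (H_op r k _ (Sbar r _ b)); lia.
Qed.
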